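(* Let $\sigma\ge 2$, $\epsilon>0$, $L_c>0$, let $N\ge 2$ be an even integer, and consider the constant space mesh $\Delta x=2L_c/N$, with grid points $x_j=-L_c+j\,\Delta x$ ($0\le j\le N$), and a constant time step $\Delta t>0$, with $t_m=m\,\Delta t$. Let $u_0\in H^1(\mathbb R)$ (complex-valued, deterministic), let $\Phi_\beta:\mathbb R\to(0,\infty)$ be an even function, and let the noise have covariance given by $\phi e_j=\sqrt{\Phi_\beta(x_j)}\,e_j$, $0\le j\le N$. Let $(u^m)_m$ be the solution of the mass-energy conservative (MEC) scheme with initial value $u^0_j=u_0(x_j)$, driven by the corresponding discretized multiplicative noise (scheme and noise as described in the context). Let $\tau^*_{\rm dis}$ be the existence time of the scheme, and let $t_M$ be a point of the time grid with $t_M<\tau^*_{\rm dis}$ almost surely. Set $$C=\frac{\sqrt3}{2}\Big(1+\frac{\sqrt{2e}}{\sqrt\pi}\Big).$$ Then $$\mathbb E\big(H_{\rm dis}[u^M]\big)\le H_{\rm dis}[u^0]+\frac{\epsilon}{2}\,M_{\rm dis}[u^0]\,\frac{C}{\sqrt{\Delta x}\,(\Delta t)^{3/2}}\Big[\sqrt{\Phi_\beta(0)}+2\sum_{j=1}^{N/2}\sqrt{\Phi_\beta(j\,\Delta x)}\Big]\,t_M,$$ and $$\mathbb E\Big(\max_{0\le m\le M}H_{\rm dis}[u^m]\Big)\le H_{\rm dis}[u^0]+\epsilon\,M_{\rm dis}[u^0]\,\frac{C}{\sqrt{\Delta x}\,(\Delta t)^{3/2}}\Big[\sqrt{\Phi_\beta(0)}+2\sum_{j=1}^{N/2}\sqrt{\Phi_\beta(j\,\Delta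 x)}\Big]\,t_M.$$
   Context: All notation is for the constant space mesh $\Delta x$ and the constant time step $\Delta t$. The subscript $\beta$ is just a parameter labelling the function $\Phi_\beta$. **Underlying equation (motivation).** The scheme discretizes the 1D focusing stochastic NLS $iu_t+u_{xx}+|u|^{2\sigma}u=\epsilon\,u\circ dW$ (Stratonovich), $u(0)=u_0$. **Grid functions.** $u^m=(u^m_0,\dots,u^m_N)\in\mathbb C^{N+1}$ approximates $u(t_m,x_j)$. Neumann boundary conditions are imposed through pseudo-points: $u^m_{-1}=u^m_0$ and $u^m_{N+1}=u^m_N$. Set $u_j^{m+\frac12}=\frac12(u_j^m+u_j^{m+1})$ and $$\mathcal D_2 f_j=\frac{f_{j-1}-2f_j+f_{j+1}}{(\Delta x)^2},\qquad 0\le j\le N.$$ **Noise basis and covariance.** $e_0,\dots,e_N$ are the following orthonormal functions in $L^2(\mathbb R)$. With $x_{j+\frac12}=\frac12(x_j+x_{j+1})$ and $c=2\sqrt3\,(\Delta x)^{-3/2}$, let $g_j(x)=c(x-x_j)$ on $[x_j,x_{j+\frac12}]$ and $g_j(x)=c(x_{j+1}-x)$ on $[x_{j+\frac12},x_{j+1}]$. Then $e_j=g_{j-1}1_{[x_{j-\frac12},x_j]}+g_j1_{[x_j,x_{j+\frac12}]}$ for $1\le j\le N-1$, $e_0=\sqrt2\,g_01_{[x_0,x_{\frac12}]}$, and $e_N=\sqrt2\,g_{N-1}1_{[x_{N-\frac12},x_N]}$. The operator $\phi$ satisfies $\phi e_j=\sqrt{\lambda_j}\,e_j$ with $\lambda_j=\Phi_\beta(x_j)$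 for $0\le j\le N$. It enters the scheme only through the numbers $\lambda_j$. **Discretized noise.** Let $\{\chi_j^{m+\frac12}: m\ge0,\ 0\le j\le N\}$ be independent standard Gaussian $\mathcal N(0,1)$ random variables. Set $$\tilde f_j^{\,m+\frac12}=\sqrt{\lambda_j}\,\frac{\sqrt3}{2}\,\frac{1}{\sqrt{\Delta t}\,\sqrt{\Delta x}}\,\chi_j^{m+\frac12},\qquad f_j^{m+\frac12}=\tfrac12\,(u_j^m+u_j^{m+1})\,\tilde f_j^{\,m+\frac12}.$$ **MEC scheme.** For $m\ge0$ and $0\le j\le N$, $$i\,\frac{u_j^{m+1}-u_j^m}{\Delta t}+\mathcal D_2u_j^{m+\frac12}+\frac1{\sigma+1}\,\frac{|u_j^{m+1}|^{2(\sigma+1)}-|u_j^m|^{2(\sigma+1)}}{|u_j^{m+1}|^2-|u_j^m|^2}\,u_j^{m+\frac12}=\epsilon f_j^{m+\frac12}.$$ When $|u_j^{m+1}|=|u_j^m|$, the difference quotient is understood as its limit $(\sigma+1)|u_j^m|^{2\sigma}$. The scheme is solved step by step: $u^{m+1}$ is obtained as a (measurable) function of $u^m$ and of $\chi^{m+\frac12}=(\chi_j^{m+\frac12})_{0\le j\le N}$. The existence time $\tau^*_{\rm dis}$ is the (random) time up to which the scheme has a solution; $t_M<\tau^*_{\rm dis}$ means in particular that $u^0,\dots,u^M$ are defined. **Discrete mass and energy.** $$M_{\rm dis}[u^m]=\Delta x\sum_{j=0}^N|u_j^m|^2,\qquad H_{\rm dis}[u^m]=\frac12\sum_{j=0}^N\Big|\frac{u_{j+1}^m-u_j^m}{\Delta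 x}\Big|^2\Delta x-\frac1{2(\sigma+1)}\sum_{j=0}^N|u_j^m|^{2(\sigma+1)}\,\Delta x.$$ *)

(* Defs.v *)
From HB Require Import structures.
From mathcomp Require Import all_boot all_order all_algebra.
From mathcomp Require Import complex.
From mathcomp Require Import all_classical all_reals all_analysis.

Set Implicit Arguments.
Unset Strict Implicit.
Unset Printing Implicit Defensive.

Import Order.TTheory GRing.Theory Num.Theory.
Import numFieldNormedType.Exports.

Local Open Scope classical_set_scope.
Local Open Scope ring_scope.

(* The Borel sigma-algebra of the complex plane, transported from R * R. *)
Definition complex_display : measure_display.
Proof. by constructor. Qed.

Section complex_measurable.
Context {R : realType}.

Definition pair_of_complex (z : R[i]) : R * R := (complex.Re z, complex.Im z).

Definition complex_measurable : set (set R[i]) :=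
  preimage_set_system setT pair_of_complex (@measurable _ (R * R)%type).

Let sigma_complex : sigma_algebra setT complex_measurable.
Proof. exact/sigma_algebra_preimage/sigma_algebra_measurable. Qed.

Let complex_measurable0 : complex_measurable set0.
Proof. by case: sigma_complex. Qed.

Let complex_measurableC A : complex_measurable A -> complex_measurable (~` A).
Proof. by case: sigma_complex => _ h _ mA; rewrite -setTD; exact: h. Qed.

Let complex_measurable_bigcup (F : (set R[i])^nat) :
  (forall i, complex_measurable (F i)) -> complex_measurable (\bigcup_i F i).
Proof. by case: sigma_complex => _ _; apply. Qed.

HB.instance Definition _ := isPointed.Build R[i] 0.

HB.instance Definition _ := @isMeasurable.Build complex_display R[i]
  complex_measurable complex_measurable0 complex_measurableC
  complex_measurable_bigcup.

End complex_measurable.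

Section independence.
Context {d : measure_display} {T : measurableType d} {R : realType}.
Context (P : probability T R).

Definition mutually_independent (I : eqType) (X : I -> {RV P >-> R}) : Prop :=
  forall (s : seq I) (A : I -> set R), uniq s -> (forall i, measurable (A i)) ->
  P (\big[setI/setT]_(i <- s) (X i @^-1` A i)) =
  (\prod_(i <- s) P (X i @^-1` A i))%E.

Definition standard_gaussian (X : {RV P >-> R}) : Prop :=
  forall A, measurable A -> distribution P X A = normal_prob 0 1 A.

End independence.

Section sobolev.
Context {R : realType}.
Implicit Types (f g phi : R -> R) (u : R -> R[i]).
Notation mu := (@lebesgue_measure R).

Definition test_function phi : Prop :=
  (forall n x, derivable (derive1n n phi) x 1) /\
  (exists A, forall x, A < `|x| -> phi x = 0).

Definition weak_derivative f g : Prop := forall phi, test_function phi ->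
  \int[mu]_x (f x * derive1 phi x) = - \int[mu]_x (g x * phi x).

(* Elements of H^1(R) are identified with their continuous representatives, so
   that the grid values u (x_j) are meaningful. *)
Definition sobolevH1_real f : Prop :=
  continuous f /\ f \in Lfun mu 2%:E /\
  exists2 g, g \in Lfun mu 2%:E & weak_derivative f g.

Definition sobolevH1 u : Prop :=
  sobolevH1_real (fun x => complex.Re (u x)) /\
  sobolevH1_real (fun x => complex.Im (u x)).

End sobolev.

Section mec.
Context {R : realType} (N : nat).
Implicit Types (u v : N.+1.-tuple R[i]) (j : 'I_N.+1).

Definition mesh (Lc : R) : R := 2 * Lc / N%:R.
Definition grid_point (Lc : R) j : R := - Lc + j%:R * mesh Lc.

Definition cabs (z : R[i]) : R := Normc.normc z.

(* u_{j-1} and u_{j+1}, with the pseudo-points u_{-1} = u_0, u_{N+1} = u_N: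
   the predecessor of 0 in nat is 0. *)
Definition left_value u j : R[i] := tnth u (inord j.-1).
Definition right_value u j : R[i] := tnth u (inord (minn j.+1 N)).

Definition D2 (dx : R) u j : R[i] :=
  (left_value u j - 2 * tnth u j + right_value u j) / ((dx ^+ 2)%:C)%C.

Definition midpoint u v : N.+1.-tuple R[i] :=
  [tuple (tnth u j + tnth v j) / 2 | j < N.+1].

(* Difference quotient of s |-> s^(sigma+1) between b^2 and a^2, extended by
   its limit at a = b (a, b are moduli, hence nonnegative). *)
Definition power_quotient (sigma a b : R) : R :=
  if a == b then (sigma + 1) * b `^ (2 * sigma)
  else (a `^ (2 * (sigma + 1)) - b `^ (2 * (sigma + 1))) / (a ^+ 2 - b ^+ 2).

(* lam j is the j-th eigenvalue lambda_j (phi e_j = sqrt lambda_j e_j), and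
   xi the vector of Gaussian increments of the current step. *)
Definition noise_term (dx dt : R) (lam : 'I_N.+1 -> R) (xi : N.+1.-tuple R) j
    : R :=
  Num.sqrt (lam j) * (Num.sqrt 3 / 2) * (Num.sqrt dt * Num.sqrt dx)^-1
    * tnth xi j.

(* v = u^{m+1} solves the scheme with data u = u^m and xi = chi^{m+1/2}. *)
Definition mec_scheme (sigma eps dx dt : R) (lam : 'I_N.+1 -> R)
    u (xi : N.+1.-tuple R) v : Prop :=
  forall j,
    ('i * ((tnth v j - tnth u j) / dt%:C)
     + D2 dx (midpoint u v) j
     + ((sigma + 1)^-1
        * power_quotient sigma (cabs (tnth v j)) (cabs (tnth u j)))%:C
       * tnth (midpoint u v) j
     = eps%:C * (tnth (midpoint u v) j * (noise_term dx dt lam xi j)%:C))%C.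

Definition discrete_mass (dx : R) u : R :=
  dx * \sum_(j < N.+1) cabs (tnth u j) ^+ 2.

Definition discrete_energy (sigma dx : R) u : R :=
  2^-1 * (\sum_(j < N.+1)
            cabs ((right_value u j - tnth u j) / (dx%:C)%C) ^+ 2 * dx)
  - (2 * (sigma + 1))^-1
    * (\sum_(j < N.+1) cabs (tnth u j) `^ (2 * (sigma + 1)) * dx).

(* D m is the set of data (u^m, chi^{m+1/2}) for which step m has a solution:
   the existence time is the first grid time t_{m+1} at which there is none
   (+oo if there is always one). *)
Definition existence_time (dt : R)
    (D : nat -> set (N.+1.-tuple R[i] * N.+1.-tuple R))
    (u : nat -> N.+1.-tuple R[i]) (xi : nat -> N.+1.-tuple R) : \bar R :=
  ereal_inf [set t | exists2 m : nat,
    ~ D m (u m, xi m) & t = (m.+1%:R * dt)%:E].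

End mec.

Definition energy_constant (R : realType) : R :=
  Num.sqrt 3 / 2 * (1 + Num.sqrt (2 * expR 1) / Num.sqrt pi).

Definition noise_sum (R : realType) (N : nat) (dx : R) (Phi : R -> R) : R :=
  Num.sqrt (Phi 0) + 2 * \sum_(1 <= j < N./2.+1) Num.sqrt (Phi (j%:R * dx)).

(* Main.v *)
Require Import Defs.
From HB Require Import structures.
From mathcomp Require Import all_boot all_order all_algebra.
From mathcomp Require Import complex.
From mathcomp Require Import all_classical all_reals all_analysis.
From mathcomp Require Import measurable_realfun ring lra.

(** Both estimates come from one pathwise bound on the energy.

    Test the scheme at site j, from data u to solution v, with the conjugate of
    the midpoint (u_j + v_j) / 2 and take imaginary parts: the nonlinearity and
    the multiplicative noise are real multiples of the midpoint and drop out,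
    and the discrete Laplacian drops out after summation over j because it is
    symmetric.  Hence the mass is conserved ([mec_mass_conserved]).  Test with
    the conjugate of v_j - u_j and take real parts: the time difference drops
    out, and the difference quotient in the nonlinearity is designed so that its
    product with |v_j|^2 - |u_j|^2 is the exact increment of the potential
    energy.  With n_j the real noise coefficient this leaves
    ([mec_energy_increment])

      H(v) - H(u) = - (eps / 2) dx sum_j n_j (|v_j|^2 - |u_j|^2).

    By conservation of mass, dx |u_j|^2 and dx |v_j|^2 both lie between 0 and
    the initial mass, so their difference is at most that mass in absolute value
    and the energy grows by at most (eps / 2) M_0 sum_j |n_j| in one step.
    Adding the steps up, at almost every sample point each of H(u^0), ...,
    H(u^M), and therefore their maximum, is at most

      H(u^0) + (eps / 2) M_0 sum_(k < M) sum_j |n_j^k|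

    ([mec_path_energy_le]).  The expectation of this bound is explicit: n_j is
    sqrt(lambda_j) (sqrt 3 / 2) / sqrt(dt dx) times a standard Gaussian, whose
    first absolute moment sqrt(2 / pi) is at most 1
    ([standard_gaussian_abs_le1]), whereas the constant C of the theorem is at
    least sqrt 3 / 2; and the sum of the sqrt(lambda_j) over the grid folds,
    by evenness of Phi, into the bracket of the theorem ([grid_sum_sqrt]). *)

Set Implicit Arguments.
Unset Strict Implicit.
Unset Printing Implicit Defensive.

Import Order.TTheory GRing.Theory Num.Theory.
Import numFieldNormedType.Exports.

Local Open Scope classical_set_scope.
Local Open Scope ring_scope.

(** * The Neumann Laplacian *)

Section neumann_laplacian.
Context (K : comPzRingType) (N : nat).
Implicit Types f g : 'I_N.+1 -> K.

Definition left_neighbour (j : 'I_N.+1) : 'I_N.+1 := inord j.-1.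
Definition right_neighbour (j : 'I_N.+1) : 'I_N.+1 := inord (minn j.+1 N).

Definition neumann_laplacian f j : K :=
  f (left_neighbour j) - 2 * f j + f (right_neighbour j).

Definition forward_difference f j : K := f (right_neighbour j) - f j.

(** No boundary terms appear: the pseudo-points make the forward difference
    vanish at the last site and the backward difference at the first. *)
Lemma summation_by_parts f g :
  \sum_j neumann_laplacian f j * g j =
  - \sum_j forward_difference f j * forward_difference g j.
Proof.
have shift : \sum_j forward_difference f j * g (right_neighbour j) =
             \sum_j (f j - f (left_neighbour j)) * g j.
  rewrite /forward_difference big_ord_recr [RHS]big_ord_recl /=.
  have -> : right_neighbour ord_max = ord_max.
    apply: val_inj; rewrite /= inordK /= ?ltnS ?geq_minr//.
    by apply/minn_idPr.
  have -> : left_neighbour ord0 = ord0 by apply: val_inj; rewrite /= inordK.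
  rewrite !subrr !mul0r addr0 add0r.
  apply: eq_bigr => j _.
  have -> : right_neighbour (widen_ord (leqnSn N) j) = lift ord0 j.
    apply: val_inj; rewrite /= inordK /= ?ltnS ?geq_minr//.
    by rewrite (minn_idPl _)//; case: j.
  suff -> : left_neighbour (lift ord0 j) = widen_ord (leqnSn N) j by [].
  by apply: val_inj; rewrite /= inordK//= add0n ltnS ltnW.
apply/eqP; rewrite -addr_eq0; apply/eqP.
have -> : \sum_j forward_difference f j * forward_difference g j =
    \sum_j forward_difference f j * g (right_neighbour j) -
    \sum_j forward_difference f j * g j.
  by rewrite -sumrB; apply: eq_bigr => j _; rewrite -mulrBr.
rewrite shift -sumrB -big_split big1//= => j _.
by rewrite /neumann_laplacian /forward_difference; ring.
Qed.

Lemma neumann_laplacian_sym f g :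
  \sum_j neumann_laplacian f j * g j = \sum_j neumann_laplacian g j * f j.
Proof.
rewrite !summation_by_parts; congr (- _).
by apply: eq_bigr => j _; rewrite mulrC.
Qed.

End neumann_laplacian.

(** * One step of the scheme: conservation of mass, increment of energy *)

Section complex_coordinates.
Context (R : rcfType).
Implicit Types (z : R[i]) (r : R).

Lemma ReMr z r : complex.Re (z * r%:C)%C = complex.Re z * r.
Proof. by case: z => a b; rewrite /= mulr0 subr0. Qed.

Lemma ImMr z r : complex.Im (z * r%:C)%C = complex.Im z * r.
Proof. by case: z => a b; rewrite /= mulr0 add0r. Qed.

Lemma Re_mulI z : complex.Re ('i * z)%C = - complex.Im z.
Proof. by case: z => a b; rewrite /= mul0r mul1r sub0r. Qed.

Lemma Im_mulI z : complex.Im ('i * z)%C = complex.Re z.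
Proof. by case: z => a b; rewrite /= mul0r mul1r add0r. Qed.

End complex_coordinates.

Lemma cabs_sqr (R : realType) (z : R[i]) :
  cabs z ^+ 2 = complex.Re z ^+ 2 + complex.Im z ^+ 2.
Proof. by case: z => a b; rewrite sqr_sqrtr// addr_ge0 ?sqr_ge0. Qed.

Lemma cabs_ge0 (R : realType) (z : R[i]) : 0 <= cabs z.
Proof. by case: z => a b; exact: sqrtr_ge0. Qed.

(** The discrete chain rule for which the nonlinearity is discretized by a
    difference quotient. *)
Lemma power_quotientM (R : realType) (sigma a b : R) : 0 <= a -> 0 <= b ->
  power_quotient sigma a b * (a ^+ 2 - b ^+ 2) =
  a `^ (2 * (sigma + 1)) - b `^ (2 * (sigma + 1)).
Proof.
move=> a0 b0; rewrite /power_quotient; case: eqVneq => [->|ab].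
  by rewrite !subrr mulr0.
by rewrite divfK// subr_eq0 eqrXn2.
Qed.

Lemma discrete_mass_ge0 (R : realType) (N : nat) (dx : R)
    (u : N.+1.-tuple R[i]) :
  0 <= dx -> 0 <= discrete_mass dx u.
Proof.
by move=> dx0; rewrite mulr_ge0// sumr_ge0// => j _; exact: sqr_ge0.
Qed.

Lemma site_mass_le (R : realType) (N : nat) (dx : R) (u : N.+1.-tuple R[i]) j :
  0 <= dx -> dx * cabs (tnth u j) ^+ 2 <= discrete_mass dx u.
Proof.
move=> dx0; rewrite ler_wpM2l// (bigD1 j)//= lerDl.
by apply: sumr_ge0 => k _; exact: sqr_ge0.
Qed.

Section scheme_step.
Context (R : realType) (N : nat) (sigma eps dx dt : R) (lam : 'I_N.+1 -> R).
Context (u : N.+1.-tuple R[i]) (xi : N.+1.-tuple R) (v : N.+1.-tuple R[i]).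
Hypothesis scheme : mec_scheme sigma eps dx dt lam u xi v.

Let mid_re j := complex.Re (tnth (midpoint u v) j).
Let mid_im j := complex.Im (tnth (midpoint u v) j).
Let nonlinearity j := (sigma + 1)^-1 *
  power_quotient sigma (cabs (tnth v j)) (cabs (tnth u j)).
Let noise j := noise_term dx dt lam xi j.

Let invrC (r : R) : ((r%:C)^-1 = (r^-1)%:C)%C.
Proof. by rewrite fmorphV. Qed.

Let two_complex : 2 = (2 : R)%:C%C :> R[i].
Proof. by rewrite rmorph_nat. Qed.

Let mid_reE j :
  mid_re j = (complex.Re (tnth u j) + complex.Re (tnth v j)) / 2.
Proof. by rewrite /mid_re tnth_mktuple two_complex invrC ReMr raddfD. Qed.

Let mid_imE j :
  mid_im j = (complex.Im (tnth u j) + complex.Im (tnth v j)) / 2.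
Proof. by rewrite /mid_im tnth_mktuple two_complex invrC ImMr raddfD. Qed.

Let cabs_sqr_increment j :
  cabs (tnth v j) ^+ 2 - cabs (tnth u j) ^+ 2 =
  2 * ((complex.Re (tnth v j) - complex.Re (tnth u j)) * mid_re j +
       (complex.Im (tnth v j) - complex.Im (tnth u j)) * mid_im j).
Proof. by rewrite !cabs_sqr mid_reE mid_imE; field. Qed.

(** Separating real and imaginary parts turns the scheme into a coupled real
    system for the coordinates of the midpoint. *)
Lemma mec_scheme_re j :
  - ((complex.Im (tnth v j) - complex.Im (tnth u j)) / dt) +
    neumann_laplacian mid_re j / dx ^+ 2 + nonlinearity j * mid_re j =
  eps * (mid_re j * noise j).
Proof.
have /(congr1 (@complex.Re R)) := scheme j.
rewrite /D2 !invrC mulr_natl mulr2n ![((_)%:C * _)%C]mulrC.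
rewrite !raddfD /= Re_mulI !(ReMr, ImMr) !(raddfN, raddfD) /= => eqj.
rewrite /neumann_laplacian mulr_natl mulr2n opprD.
by rewrite [nonlinearity j * _]mulrC [eps * _]mulrC.
Qed.

Lemma mec_scheme_im j :
  (complex.Re (tnth v j) - complex.Re (tnth u j)) / dt +
    neumann_laplacian mid_im j / dx ^+ 2 + nonlinearity j * mid_im j =
  eps * (mid_im j * noise j).
Proof.
have /(congr1 (@complex.Im R)) := scheme j.
rewrite /D2 !invrC mulr_natl mulr2n ![((_)%:C * _)%C]mulrC.
rewrite !raddfD /= Im_mulI !(ReMr, ImMr) !(raddfN, raddfD) /= => eqj.
rewrite /neumann_laplacian mulr_natl mulr2n opprD.
by rewrite [nonlinearity j * _]mulrC [eps * _]mulrC.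
Qed.

Hypotheses (dx0 : dx != 0) (dt0 : dt != 0).

(** The imaginary part of the scheme tested with the conjugate midpoint: noise
    and nonlinearity cancel site by site, the Laplacian only in the sum. *)
Lemma mec_mass_conserved : discrete_mass dx v = discrete_mass dx u.
Proof.
rewrite /discrete_mass; congr (_ * _); apply/eqP; rewrite -subr_eq0 -sumrB.
have eqj j : cabs (tnth v j) ^+ 2 - cabs (tnth u j) ^+ 2 =
    2 * dt / dx ^+ 2 * (neumann_laplacian mid_re j * mid_im j -
                        neumann_laplacian mid_im j * mid_re j).
  have [im_eq re_eq] := (mec_scheme_re j, mec_scheme_im j).
  set lr := neumann_laplacian mid_re j in im_eq *.
  set li := neumann_laplacian mid_im j in re_eq *.
  have {}re_eq : complex.Re (tnth v j) - complex.Re (tnth u j) =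
      dt * (eps * (mid_im j * noise j) - nonlinearity j * mid_im j -
            li / dx ^+ 2) by rewrite -re_eq; field; rewrite ?dx0 ?dt0.
  have {}im_eq : complex.Im (tnth v j) - complex.Im (tnth u j) =
      - dt * (eps * (mid_re j * noise j) - nonlinearity j * mid_re j -
              lr / dx ^+ 2) by rewrite -im_eq; field; rewrite ?dx0 ?dt0.
  rewrite cabs_sqr_increment re_eq im_eq.
  by field.
under eq_bigr do rewrite eqj.
by rewrite -mulr_sumr sumrB neumann_laplacian_sym subrr mulr0.
Qed.

(** The real part of the scheme tested with the conjugate of [v - u].  The
    Laplacian of the midpoint against [v - u] is computed twice: by summation by
    parts it is minus half the increment of the squared gradient, and by the
    scheme it is what noise and nonlinearity contribute. *)
Lemma mec_energy_increment : sigma + 1 != 0 ->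
  discrete_energy sigma dx v = discrete_energy sigma dx u -
  eps / 2 * (dx * \sum_j noise j *
                    (cabs (tnth v j) ^+ 2 - cabs (tnth u j) ^+ 2)).
Proof.
move=> sigma0.
pose dre j := complex.Re (tnth v j) - complex.Re (tnth u j).
pose dim j := complex.Im (tnth v j) - complex.Im (tnth u j).
pose grad2 (w : N.+1.-tuple R[i]) j : R :=
  forward_difference (fun k => complex.Re (tnth w k)) j ^+ 2 +
  forward_difference (fun k => complex.Im (tnth w k)) j ^+ 2.
have grad2E w j : cabs ((right_value w j - tnth w j) / (dx%:C)%C) ^+ 2 * dx =
    grad2 w j / dx.
  rewrite cabs_sqr invrC ReMr ImMr !raddfB /=.
  by rewrite /grad2 /forward_difference; field.
have sbp : \sum_j (neumann_laplacian mid_re j * dre j +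
                   neumann_laplacian mid_im j * dim j) =
    - (2^-1 * \sum_j (grad2 v j - grad2 u j)).
  rewrite big_split !summation_by_parts /= -opprD -big_split mulr_sumr.
  congr (- _); apply: eq_bigr => j _ /=.
  by rewrite /grad2 /forward_difference /dre /dim !mid_reE !mid_imE; field.
have step : \sum_j (neumann_laplacian mid_re j * dre j +
                    neumann_laplacian mid_im j * dim j) =
    dx ^+ 2 / 2 * \sum_j ((eps * noise j - nonlinearity j) *
                   (cabs (tnth v j) ^+ 2 - cabs (tnth u j) ^+ 2)).
  rewrite mulr_sumr; apply: eq_bigr => j _.
  rewrite cabs_sqr_increment -/(dre j) -/(dim j).
  have [im_eq re_eq] := (mec_scheme_re j, mec_scheme_im j).
  rewrite -/(dre j) in re_eq; rewrite -/(dim j) in im_eq.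
  have -> : neumann_laplacian mid_re j = dx ^+ 2 * (eps * (mid_re j * noise j) -
      nonlinearity j * mid_re j + dim j / dt).
    by rewrite -im_eq; field; rewrite ?dx0 ?dt0.
  have -> : neumann_laplacian mid_im j = dx ^+ 2 * (eps * (mid_im j * noise j) -
      nonlinearity j * mid_im j - dre j / dt).
    by rewrite -re_eq; field; rewrite ?dx0 ?dt0.
  by field.
have {}step := etrans (esym sbp) step.
apply/eqP; rewrite -subr_eq0; apply/eqP.
have -> : discrete_energy sigma dx v = 2^-1 * (\sum_j grad2 v j) / dx -
   (2 * (sigma + 1))^-1 * (\sum_j cabs (tnth v j) `^ (2 * (sigma + 1))) * dx.
  rewrite /discrete_energy; under eq_bigr do rewrite grad2E.
  by rewrite -!mulr_suml !mulrA.
have -> : discrete_energy sigma dx u = 2^-1 * (\sum_j grad2 u j) / dx -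
   (2 * (sigma + 1))^-1 * (\sum_j cabs (tnth u j) `^ (2 * (sigma + 1))) * dx.
  rewrite /discrete_energy; under eq_bigr do rewrite grad2E.
  by rewrite -!mulr_suml !mulrA.
have nl : \sum_j nonlinearity j *
                  (cabs (tnth v j) ^+ 2 - cabs (tnth u j) ^+ 2) =
   (sigma + 1)^-1 * (\sum_j cabs (tnth v j) `^ (2 * (sigma + 1)) -
      \sum_j cabs (tnth u j) `^ (2 * (sigma + 1))).
  rewrite -sumrB mulr_sumr; apply: eq_bigr => j _.
  by rewrite -mulrA power_quotientM ?cabs_ge0.
move: step; under [in RHS]eq_bigr do rewrite mulrBl -mulrA.
rewrite sumrB sumrB -mulr_sumr nl.
set gv := \sum_j grad2 v j; set gu := \sum_j grad2 u j.
set pv := \sum_j _ `^ _; set pu := \sum_j _ `^ _; set s := \sum_j _ => step.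
have -> : gv = gu - dx ^+ 2 * (eps * s - (sigma + 1)^-1 * (pv - pu)).
  transitivity (gu - 2 * - (2^-1 * (gv - gu))); first by field.
  by rewrite step; field.
by field; rewrite dx0 sigma0.
Qed.

(** Conservation of mass bounds the factor of each noise coefficient: a
    difference of two numbers between 0 and the mass is at most the mass in
    absolute value. *)
Lemma mec_energy_step_le : 0 <= eps -> 0 < dx -> sigma + 1 != 0 ->
  discrete_energy sigma dx v <=
  discrete_energy sigma dx u + eps / 2 * discrete_mass dx u * \sum_j `|noise j|.
Proof.
move=> eps0 dx_gt0 sigma0; rewrite mec_energy_increment// lerD2l -mulrN -mulrA.
rewrite ler_wpM2l ?divr_ge0// !mulr_sumr -sumrN; apply: ler_sum => j _.
have := site_mass_le v j (ltW dx_gt0); have := site_mass_le u j (ltW dx_gt0).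
rewrite mec_mass_conserved.
have := mulr_ge0 (ltW dx_gt0) (sqr_ge0 (cabs (tnth u j))).
have := mulr_ge0 (ltW dx_gt0) (sqr_ge0 (cabs (tnth v j))).
set mv := dx * cabs (tnth v j) ^+ 2; set mu := dx * cabs (tnth u j) ^+ 2.
set m := discrete_mass _ _.
move=> mv0 mu0 mum mvm.
have -> : - (dx * (noise j * (cabs (tnth v j) ^+ 2 - cabs (tnth u j) ^+ 2))) =
    noise j * (mu - mv) by rewrite /mu /mv; ring.
rewrite (le_trans (ler_norm _))// normrM mulrC ler_wpM2r//.
by rewrite ler_norml; lra.
Qed.

End scheme_step.

(** * Trajectories of the scheme *)

Section scheme_path.
Context (R : realType) (N : nat) (sigma eps dx dt : R) (lam : 'I_N.+1 -> R).
Context (u : nat -> N.+1.-tuple R[i]) (xi : nat -> N.+1.-tuple R) (M : nat).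
Hypothesis scheme : forall m, (m < M)%N ->
  mec_scheme sigma eps dx dt lam (u m) (xi m) (u m.+1).
Hypotheses (eps0 : 0 <= eps) (dx0 : 0 < dx) (dt0 : dt != 0).
Hypothesis sigma0 : sigma + 1 != 0.

Lemma mec_path_mass m : (m <= M)%N ->
  discrete_mass dx (u m) = discrete_mass dx (u 0%N).
Proof.
elim: m => [//|m IHm mM]; rewrite -IHm; last exact: ltnW.
by apply: (mec_mass_conserved (scheme mM)) => //; rewrite gt_eqF.
Qed.

(** The noise is summed over all [M] steps whatever the value of [m], so that
    the same bound dominates the maximum of the energies. *)
Lemma mec_path_energy_le m : (m <= M)%N ->
  discrete_energy sigma dx (u m) <= discrete_energy sigma dx (u 0%N) +
  eps / 2 * discrete_mass dx (u 0%N) *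
    \sum_(k < M) \sum_j `|noise_term dx dt lam (xi k) j|.
Proof.
move=> mM; pose step_noise k : R := \sum_j `|noise_term dx dt lam (xi k) j|.
suff : discrete_energy sigma dx (u m) <= discrete_energy sigma dx (u 0%N) +
    eps / 2 * discrete_mass dx (u 0%N) * \sum_(k < m) step_noise k.
  move=> /le_trans; apply; rewrite lerD2l ler_wpM2l//.
    by rewrite mulr_ge0 ?divr_ge0 ?discrete_mass_ge0// ltW.
  rewrite -[leRHS](big_mkord xpredT step_noise) -(big_mkord xpredT step_noise).
  rewrite [leRHS](big_cat_nat (leq0n m) mM)//= lerDl.
  by apply: sumr_ge0 => k _; apply: sumr_ge0.
elim: m mM => [_|m IHm mM]; first by rewrite big_ord0 mulr0 addr0.
have dx_neq0 : dx != 0 by rewrite gt_eqF.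
have := mec_energy_step_le (scheme mM) dx_neq0 dt0 eps0 dx0 sigma0.
rewrite mec_path_mass; last exact: ltnW.
move=> /le_trans; apply.
rewrite [\sum_(k < m.+1) _]big_ord_recr/= mulrDr addrA lerD2r.
by rewrite IHm// ltnW.
Qed.

End scheme_path.

(** A failure at step [m] would put the existence time at [m.+1 * dt] at the
    latest, which is at most [M * dt]. *)
Lemma lt_existence_time (R : realType) (N : nat) (dt : R)
    (D : nat -> set (N.+1.-tuple R[i] * N.+1.-tuple R)) u xi M m :
  0 <= dt -> ((M%:R * dt)%:E < existence_time dt D u xi)%E -> (m < M)%N ->
  D m (u m, xi m).
Proof.
move=> dt0 ltM mM; apply: contrapT => nD; move: ltM; apply/negP; rewrite -leNgt.
apply: (@le_trans _ _ (m.+1%:R * dt)%:E).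
  by apply: ereal_inf_lbound; exists m.
by rewrite lee_fin ler_wpM2r// ler_nat.
Qed.

(** * First absolute moment of a standard Gaussian *)

Section gaussian_first_moment.
Context {R : realType}.
Notation mu := (@lebesgue_measure R).

(** The density of the normal law agrees almost everywhere with its
    Radon-Nikodym derivative, having the same integrals over measurable sets. *)
Lemma ge0_integral_normal_prob (m s : R) (f : R -> \bar R) :
  measurable_fun setT f -> (forall x, 0 <= f x)%E ->
  (\int[normal_prob m s]_x f x = \int[mu]_x (f x * (normal_pdf m s x)%:E))%E.
Proof.
move=> mf f0; have dom := normal_prob_dominates m s.
rewrite -(Radon_Nikodym_SigmaFinite.change_of_variables dom)//.
apply: ae_eq_integral => //.
- apply: emeasurable_funM => //.
  exact: measurable_int (Radon_Nikodym_SigmaFinite.f_integrable _).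
- apply: emeasurable_funM => //; apply/measurable_EFinP.
  exact: measurable_normal_pdf.
- apply: ae_eqe_mul2l; apply: integral_ae_eq => //.
  + exact: Radon_Nikodym_SigmaFinite.f_integrable.
  + by apply/measurable_EFinP; exact: measurable_normal_pdf.
  + by move=> E _ mE; rewrite -Radon_Nikodym_SigmaFinite.f_integral.
Qed.

(* The standard normal density p satisfies p' x = - x * p x, so - p is a
   primitive of the integrand on the half-line. *)
Let half_moment :
  (\int[mu]_(x in `[0%R, +oo[) (`|x| * normal_pdf 0 1 x)%:E
   = (normal_peak (1 : R))%:E)%E.
Proof.
have pdfE x : normal_pdf 0 1 x = normal_peak 1 * expR (- (x ^+ 2 / 2)) :> R.
  by rewrite normal_pdfE// /normal_fun subr0 expr1n mulNr.
have dpdf (x : R) : is_derive x (1 : R) (fun x => - normal_pdf 0 1 x : R)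
    (x * normal_pdf 0 1 x).
  pose g : R -> R := - (2^-1 *: (@idfun R ^+ 2)).
  have -> : (fun x => - normal_pdf 0 1 x : R) =
      - (normal_peak 1 *: (expR \o g)) :> (R -> R).
    apply/funext => y; rewrite pdfE /g !fctE /=.
    by rewrite [_ / 2]mulrC.
  apply: is_derive_eq.
  have -> : g x = - (x ^+ 2 / 2) by rewrite /g !fctE mulrC.
  by rewrite pdfE /GRing.scale /= mulr1 expr1; field.
have cpdf : continuous (fun x : R => - normal_pdf 0 1 x : R).
  by move=> x; apply: (@cvgN _ R^o); exact: continuous_normal_pdf.
rewrite (@ge0_continuous_FTC2y _ _ (fun x => - normal_pdf 0 1 x) _ 0)//.
- rewrite sub0e EFinN oppeK normal_pdfE// /normal_fun subr0 expr0n/=.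
  by rewrite oppr0 mul0r expR0 mulr1.
- by move=> x x0; rewrite mulr_ge0 ?normal_pdf_ge0.
- apply: continuous_subspaceT => x; apply: cvgM; first exact: norm_continuous.
  exact: continuous_normal_pdf.
- rewrite -[X in _ --> X]oppr0; apply: cvgN.
  rewrite (funext pdfE).
  rewrite -[X in _ --> X](mulr0 (normal_peak 1)).
  apply: cvgM; first exact: cvg_cst.
  apply: (cvg_comp (fun x => x ^+ 2 / 2) (fun x => expR (- x))).
    by apply: gt0_cvgMly => //; exact: cvgr_expr2.
  exact: cvgr_expR.
- exact/cvg_at_right_filter/cpdf.
- move=> x; rewrite in_itv/= andbT => x0.
  by rewrite derive1E (@derive_val _ _ _ _ _ _ _ (dpdf x)) gtr0_norm.
Qed.

(** [normal_peak 1] is [1 / sqrt (2 * pi)], so the moment is [sqrt (2 / pi)]. *)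
Lemma integral_normal_abs :
  (\int[normal_prob 0 1]_x `|x|%:E = (2 * normal_peak (1 : R))%:E)%E.
Proof.
rewrite ge0_integral_normal_prob//; last exact/measurable_EFinP.
under eq_integral do rewrite -EFinM.
rewrite ge0_symfun_integralT//=.
- by rewrite -set_itvcy half_moment EFinM.
- by move=> x; rewrite mulr_ge0 ?normal_pdf_ge0.
- move=> x; apply: cvgM; first exact: norm_continuous.
  exact: continuous_normal_pdf.
- by move=> x /=; rewrite normrN !normal_pdfE// /normal_fun !subr0 sqrrN.
Qed.

Lemma two_normal_peak_le1 : 2 * normal_peak (1 : R) <= 1.
Proof.
have pi2 := pi_ge2 R.
have tau_gt0 : 0 < pi *+ 2 :> R by lra.
rewrite /normal_peak expr1n mul1r ler_pdivrMr ?sqrtr_gt0// mul1r.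
by rewrite -[leLHS]ger0_norm// -sqrtr_sqr ler_sqrt ?(ltW tau_gt0)//; lra.
Qed.

End gaussian_first_moment.

Lemma standard_gaussian_abs {d} {T : measurableType d} {R : realType}
  (P : probability T R) (X : {RV P >-> R}) : standard_gaussian X ->
  (\int[P]_w `|X w|%:E = (2 * normal_peak (1 : R))%:E)%E.
Proof.
move=> gX; rewrite -integral_normal_abs.
(* The normal law is a measure on the generated Borel sigma-algebra of
   [measurableTypeR R], while X takes its values in R with the default display;
   Y is X with the former codomain. *)
have mX : measurable_fun [set: T] (X : T -> measurableTypeR R).
  exact: (measurable_funPT X).
pose mX_mixin := isMeasurableFun.Build _ _ _ _ _ mX.
pose Y : {RV P >-> measurableTypeR R} :=
  HB.pack (X : T -> measurableTypeR R) mX_mixin.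
transitivity (\int[distribution P Y]_x `|x|%:E)%E.
  rewrite ge0_integral_distribution//.
  by apply/measurable_EFinP; exact: (@normr_measurable R setT).
apply: eq_measure_integral => A mA _; exact: gX.
Qed.

Lemma standard_gaussian_abs_le1 {d} {T : measurableType d} {R : realType}
  (P : probability T R) (X : {RV P >-> R}) : standard_gaussian X ->
  (\int[P]_w `|X w|%:E <= 1)%E.
Proof.
by move=> gX; rewrite standard_gaussian_abs// lee_fin two_normal_peak_le1.
Qed.

(** * Comparison of integrals *)

(** Integrals of nonnegative functions are suprema over the simple functions
    below them, hence monotone for arbitrary functions; raising [g] to infinity
    on the exceptional null set makes the comparison hold everywhere, and as [g]
    is measurable this does not change its integral. *)
Lemma le_integral_ae {d} {T : measurableType d} {R : realType}
  (mu : {measure set T -> \bar R}) (f g : T -> \bar R) :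
  measurable_fun setT g -> {ae mu, forall x, f x <= g x}%E ->
  (\int[mu]_x f x <= \int[mu]_x g x)%E.
Proof.
move=> mg [N [mN N0 fgN]].
pose g' x := if x \in N then +oo%E else g x.
have mg' : measurable_fun setT g'.
  apply: measurable_fun_ifT => //.
  by apply: (measurable_fun_bool true); rewrite setTI preimage_mem_true.
have -> : (\int[mu]_x g x = \int[mu]_x g' x)%E.
  apply: ae_eq_integral => //; exists N; split => // x /= gg'.
  by apply: contrapT => Nx; apply: gg' => _; rewrite /g' memNset.
have fg' x : (f x <= g' x)%E.
  rewrite /g'; case: ifPn => [_|/negP Nx]; first exact: leey.
  by apply: contrapT => fgx; apply: Nx; apply/mem_set/fgN.
rewrite /integral !patch_setT; apply: leeB.
  apply: le_ereal_sup => _ [h hf <-]; exists h => // x.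
  by rewrite (le_trans (hf x))// (@funepos_le _ _ setT)// ?inE.
apply: le_ereal_sup => _ [h hf <-]; exists h => // x.
by rewrite (le_trans (hf x))// (@funeneg_le _ _ setT)// ?inE.
Qed.

(** * Noise intensity on the grid *)

(** [N] being even, the grid point of index [N / 2] is the origin, and the grid
    is symmetric about it. *)
Lemma grid_sum_sqrt (R : realType) (N : nat) (Lc : R) (Phi : R -> R) :
  (0 < N)%N -> ~~ odd N -> (forall x, Phi (- x) = Phi x) ->
  \sum_(j < N.+1) Num.sqrt (Phi (grid_point Lc j)) =
  noise_sum N (mesh N Lc) Phi.
Proof.
move=> N0 evenN evenPhi; pose n := N./2; set dx := mesh N Lc.
have NE : N = (n + n)%N by rewrite addnn even_halfK.
have LcE : Lc = n%:R * dx.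
  have : N%:R != 0 :> R by rewrite pnatr_eq0 -lt0n.
  by rewrite /dx /mesh NE natrD => ?; field.
pose g k := Num.sqrt (Phi (k%:R * dx)).
have right_point k : Num.sqrt (Phi (- Lc + (n + k)%:R * dx)) = g k.
  by rewrite LcE natrD; congr (Num.sqrt (Phi _)); ring.
have left_point k : (k < n)%N ->
    Num.sqrt (Phi (- Lc + (n - k.+1)%:R * dx)) = g k.+1.
  move=> kn; rewrite LcE natrB// -[LHS]/(Num.sqrt _) /g -evenPhi.
  by congr (Num.sqrt (Phi _)); ring.
rewrite /noise_sum /grid_point -/dx -/n big_add1 /=.
rewrite -(big_mkord xpredT (fun j => Num.sqrt (Phi (- Lc + j%:R * dx)))).
rewrite (@big_cat_nat _ _ _ n)//=; last by rewrite NE -addnS leq_addr.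
rewrite big_nat_rev /= add0n.
rewrite (eq_big_nat _ _ (F2 := fun k => g k.+1)); last first.
  by move=> k /= kn; exact: left_point.
have -> : \sum_(n <= j < N.+1) Num.sqrt (Phi (- Lc + j%:R * dx)) =
    \sum_(0 <= k < n.+1) g k.
  rewrite -{1}[n]add0n big_addn NE -addnS addKn.
  by apply: eq_bigr => k _; rewrite addnC right_point.
by rewrite big_nat_recl// /g mul0r; ring.
Qed.

Lemma noise_sum_ge0 (R : realType) (N : nat) (dx : R) (Phi : R -> R) :
  0 <= noise_sum N dx Phi.
Proof. by rewrite addr_ge0 ?mulr_ge0 ?sumr_ge0. Qed.

Lemma integral_noise_le {d} {T : measurableType d} {R : realType}
    (P : probability T R) (N M : nat) (dx dt : R) (lam : 'I_N.+1 -> R)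
    (chi : nat -> 'I_N.+1 -> {RV P >-> R}) :
  (forall m j, standard_gaussian (chi m j)) ->
  (\int[P]_w (\sum_(k < M) \sum_j
     `|noise_term dx dt lam [tuple chi k i w | i < N.+1] j|)%:E <=
   (M%:R * (Num.sqrt 3 / 2 * (Num.sqrt dt * Num.sqrt dx)^-1 *
     \sum_j Num.sqrt (lam j)))%:E)%E.
Proof.
move=> gauss; pose c := Num.sqrt 3 / 2 * (Num.sqrt dt * Num.sqrt dx)^-1.
have c0 : 0 <= c by rewrite mulr_ge0 ?invr_ge0 ?mulr_ge0.
have termE k j w : `|noise_term dx dt lam [tuple chi k i w | i < N.+1] j| =
    Num.sqrt (lam j) * c * `|chi k j w|.
  rewrite /noise_term tnth_mktuple normrM ger0_norm.
    by rewrite /c !mulrA.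
  by rewrite -mulrA -/c mulr_ge0 ?sqrtr_ge0.
have mchi k j : measurable_fun setT (fun w => `|chi k j w|%:E).
  by apply/measurable_EFinP; exact: measurableT_comp.
have mterm k j : measurable_fun setT (fun w =>
    `|noise_term dx dt lam [tuple chi k i w | i < N.+1] j|%:E).
  under eq_fun do rewrite termE EFinM.
  exact: measurable_funeM.
under eq_integral do rewrite -sumEFin.
rewrite ge0_integral_sum//; last 2 first.
- by move=> k; under eq_fun do rewrite -sumEFin; exact: emeasurable_sum.
- by move=> k w _; rewrite lee_fin sumr_ge0.
rewrite -[M in leRHS]card_ord mulr_natl -sumr_const -sumEFin.
apply: lee_sum => k _.
under eq_integral do rewrite -sumEFin.
rewrite ge0_integral_sum// mulr_sumr -sumEFin; apply: lee_sum => j _.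
under eq_integral do rewrite termE EFinM.
rewrite ge0_integralZl//; last by rewrite lee_fin mulr_ge0.
rewrite [c * _]mulrC -[leRHS]mule1 lee_wpmul2l ?lee_fin ?mulr_ge0//.
exact: standard_gaussian_abs_le1.
Qed.

Lemma measurable_noise {d} {T : measurableType d} {R : realType}
    (P : probability T R) (N M : nat) (dx dt : R) (lam : 'I_N.+1 -> R)
    (chi : nat -> 'I_N.+1 -> {RV P >-> R}) :
  measurable_fun setT (fun w => \sum_(k < M) \sum_j
     `|noise_term dx dt lam [tuple chi k i w | i < N.+1] j|).
Proof.
apply: measurable_sum => k; apply: measurable_sum => j.
apply: measurableT_comp => //; rewrite /noise_term.
under eq_fun do rewrite tnth_mktuple.
by apply: measurable_funM => //; exact: measurable_funPT.
Qed.

(** * Energy estimates *)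

Theorem proposition3p1 (R : realType)
    (d : measure_display) (T : measurableType d) (P : probability T R)
    (sigma eps Lc dt : R) (N : nat)
    (hsigma : 2 <= sigma) (heps : 0 < eps) (hLc : 0 < Lc) (hdt : 0 < dt)
    (hN : (2 <= N)%N) (hNeven : ~~ odd N)
    (u0 : R -> R[i]) (hu0 : sobolevH1 u0)
    (Phi : R -> R) (hPhi_gt0 : forall x, 0 < Phi x)
    (hPhi_even : forall x, Phi (- x) = Phi x)
    (chi : nat -> 'I_N.+1 -> {RV P >-> R})
    (hchi_normal : forall m j, standard_gaussian (chi m j))
    (hchi_indep : mutually_independent
       (fun k : nat * 'I_N.+1 => chi k.1 k.2))
    (* domain and values of the (measurable) solution map of each time step;
       the values of S m outside D m are irrelevant *)
    (D : nat -> set (N.+1.-tuple R[i] * N.+1.-tuple R))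
    (S : nat -> N.+1.-tuple R[i] * N.+1.-tuple R -> N.+1.-tuple R[i])
    (hS_meas : forall m, measurable_fun setT (S m))
    (hS_scheme : forall m v xi, D m (v, xi) ->
       mec_scheme sigma eps (mesh N Lc) dt
         (fun j => Phi (grid_point Lc j)) v xi (S m (v, xi)))
    (u : nat -> T -> N.+1.-tuple R[i])
    (hu_init : forall w, u 0%N w = [tuple u0 (grid_point Lc j) | j < N.+1])
    (hu_step : forall m w,
       u m.+1 w = S m (u m w, [tuple chi m j w | j < N.+1]))
    (M : nat)
    (hM : {ae P, forall w, ((M%:R * dt)%:E <
       existence_time dt D (u ^~ w)
         (fun m => [tuple chi m j w | j < N.+1]))%E}) :
  let dx := mesh N Lc in
  let tM := M%:R * dt in
  let v0 := [tuple u0 (grid_point Lc j) | j < N.+1] in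
  let H := discrete_energy sigma dx in
  let B := energy_constant R / (Num.sqrt dx * dt `^ (3 / 2))
           * noise_sum N dx Phi in
  ('E_P[fun w => H (u M w)] <=
     (H v0 + eps / 2 * discrete_mass dx v0 * B * tM)%:E)%E /\
  ('E_P[fun w => \big[Num.max/H (u 0%N w)]_(m < M.+1) H (u m w)] <=
     (H v0 + eps * discrete_mass dx v0 * B * tM)%:E)%E.
Proof.
move=> dx tM v0 H B.
have dx0 : 0 < dx by rewrite divr_gt0 ?mulr_gt0// ltr0n (leq_trans _ hN).
pose xi m w : N.+1.-tuple R := [tuple chi m j w | j < N.+1].
pose lam (j : 'I_N.+1) := Phi (grid_point Lc j).
pose G w : R := \sum_(k < M) \sum_j `|noise_term dx dt lam (xi k w) j|.
pose b := eps / 2 * discrete_mass dx v0.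
have path : {ae P, forall w m, (m <= M)%N -> H (u m w) <= H v0 + b * G w}.
  apply: filterS hM => w hw m mM; rewrite /H /b /v0 -(hu_init w).
  apply: (@mec_path_energy_le _ _ sigma eps dx dt lam (u ^~ w) (xi ^~ w)) => //.
  - move=> k kM; rewrite hu_step; apply: hS_scheme.
    exact: (lt_existence_time (ltW hdt) hw).
  - exact: ltW.
  - by rewrite gt_eqF.
  - by rewrite gt_eqF//; lra.
have b0 : 0 <= b by rewrite mulr_ge0 ?divr_ge0 ?discrete_mass_ge0 ?ltW.
have mG : measurable_fun setT G by exact: measurable_noise.
have G0 w : 0 <= G w by apply: sumr_ge0 => k _; apply: sumr_ge0.
have EG := integral_noise_le M dx dt lam hchi_normal.
have noise_le : M%:R * (Num.sqrt 3 / 2 * (Num.sqrt dt * Num.sqrt dx)^-1 *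
    \sum_j Num.sqrt (lam j)) <= B * tM.
  rewrite (grid_sum_sqrt _ _ hNeven hPhi_even) ?(leq_trans _ hN)// -/dx.
  have dt32 : dt `^ (3 / 2) = dt * Num.sqrt dt.
    have -> : 3 / 2 = 1 + 2^-1 :> R by field.
    by rewrite powRD ?(gt_eqF hdt) ?implybT// powRr1 ?powR12_sqrt ?ltW.
  have sdt0 : 0 < Num.sqrt dt by rewrite sqrtr_gt0.
  have sdx0 : 0 < Num.sqrt dx by rewrite sqrtr_gt0.
  have -> : B * tM = M%:R *
      (energy_constant R * (Num.sqrt dt * Num.sqrt dx)^-1 *
       noise_sum N dx Phi).
    rewrite /B /tM dt32; field.
    by rewrite !gt_eqF.
  rewrite ler_wpM2l// ler_wpM2r ?noise_sum_ge0//.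
  rewrite ler_wpM2r ?invr_ge0 ?mulr_ge0//.
  (* The first summand of C alone is sqrt 3 / 2. *)
  by rewrite /energy_constant mulrDr mulr1 lerDl !mulr_ge0 ?invr_ge0.
have BtM0 : 0 <= B * tM.
  by apply: le_trans noise_le; rewrite !mulr_ge0 ?invr_ge0 ?mulr_ge0 ?sumr_ge0.
have EbG : (\int[P]_w (H v0 + b * G w)%:E <= (H v0 + b * B * tM)%:E)%E.
  have iG : P.-integrable setT (EFin \o G).
    apply/integrableP; split; first exact/measurable_EFinP.
    under eq_integral do rewrite /= ger0_norm//.
    exact: le_lt_trans EG (ltry _).
  under eq_integral do rewrite EFinD EFinM.
  rewrite integralD//; last 2 first.
  - exact: finite_measure_integrable_cst.
  - exact: integrableZl.
  have -> : (\int[P]_w (H v0)%:E = (H v0)%:E)%E.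
    by rewrite -[RHS](expectation_cst P) expectation.unlock.
  rewrite [leRHS]EFinD leeD2l// integralZl//.
  have -> : (b * B * tM)%:E = (b%:E * (B * tM)%:E)%E.
    by rewrite -EFinM (mulrA b B tM).
  by rewrite lee_wpmul2l ?lee_fin// (le_trans EG)// lee_fin.
have expectation_le (X : T -> R) : {ae P, forall w, X w <= H v0 + b * G w} ->
    ('E_P[X] <= (H v0 + b * B * tM)%:E)%E.
  move=> XG; rewrite expectation.unlock.
  apply: le_trans EbG; apply: le_integral_ae.
    apply/measurable_EFinP; apply: measurable_funD => //.
    exact: measurable_funM.
  by apply: filterS XG => w; rewrite lee_fin.
split.
  by rewrite -/b; apply: expectation_le; apply: filterS path => w; apply.
apply: le_trans (expectation_le _ _) _.
  apply: filterS path => w Hw; apply: bigmax_le => [|m _]; first exact: Hw.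
  by apply: Hw; rewrite -ltnS.
(* The maximum obeys the bound with eps / 2, which is below the one with eps. *)
rewrite lee_fin lerD2l -[leLHS]mulrA -[leRHS]mulrA ler_wpM2r//.
by rewrite ler_wpM2r ?discrete_mass_ge0 ?(ltW dx0)//; lra.
Qed.
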